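(* Let $\omega=\{\omega_n\}_{n\ge 0}$ be a sequence of positive real numbers with $\omega_0=1$ and $\lim_{n\to\infty}\omega_n/\omega_{n+1}=1$, and let $$\mathcal{U}_\omega:=\sup_{f\in H^2_\omega,\ f\neq 0}\frac{|\langle f,zf\rangle_\omega|}{\|zf\|_\omega^2}.$$ (A) If there exist $n,k\in\mathbb{N}$ such that $\omega_{k+n+1}<\omega_{k+1}/4$, then $\mathcal{U}_\omega>1$ and the supremum defining $\mathcal{U}_\omega$ is a maximum, i.e., an extremal function exists. (B) If $\omega$ is nondecreasing, then $\mathcal{U}_\omega=1$ and the supremum defining $\mathcal{U}_\omega$ is not a maximum, i.e., there is no extremal function.
   Context: $\mathbb{N}=\{1,2,\dots\}$. $H^2_\omega$ is the Hilbert space of functions $f(z)=\sum_{n\ge0}a_nz^n$ analytic in the open unit disk $\mathbb{D}$ with $\|f\|_\omega^2=\sum_{n\ge0}|a_n|^2\omega_n<\infty$ and inner product $\langle \sum a_nz^n,\sum b_nz^n\rangle_\omega=\sum_{n\ge0}a_n\overline{b_n}\,\omega_n$. An extremal function is a nonzero $f\in H^2_\omega$ for which the quotient equals $\mathcal{U}_\omega$. *)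

(* Defs.v *)
From Stdlib Require Import Reals Lra ClassicalEpsilon.
From Coquelicot Require Import Coquelicot.

Open Scope R_scope.

(* Functions analytic in the open unit disk are represented by total functions
   C -> C; values outside the disk are irrelevant to every notion below. *)
Definition expansion (f : C -> C) (a : nat -> C) : Prop :=
  forall z : C, Cmod z < 1 -> is_pseries a z (f z).

Lemma expansion_unique (f : C -> C) (a b : nat -> C) :
  expansion f a -> expansion f b -> forall n, a n = b n.
Proof.
assert (pow_real : forall (x : R) n, pow_n (RtoC x : C_AbsRing) n = RtoC (x ^ n)).
{ intros x n; induction n as [|n IH]; [reflexivity|].
  simpl; rewrite IH; unfold mult; simpl; now rewrite <- RtoC_mult. }
assert (parts : forall (g : C -> C) c, expansion g c -> forall x, Rabs x < 1 ->
  is_pseries (fun n => Re (c n)) x (Re (g (RtoC x))) /\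
  is_pseries (fun n => Im (c n)) x (Im (g (RtoC x)))).
{ intros g c Hc x Hx.
  assert (H : is_pseries c (RtoC x) (g (RtoC x)))
    by (apply Hc; now rewrite Cmod_R).
  assert (sums : forall n,
    sum_n (fun k => scal (pow_n (RtoC x : C_AbsRing) k) (c k : C_NormedModule)) n =
    (sum_n (fun k => scal (pow_n x k) (Re (c k))) n,
     sum_n (fun k => scal (pow_n x k) (Im (c k))) n)).
  { assert (term : forall k,
      scal (pow_n (RtoC x : C_AbsRing) k) (c k : C_NormedModule) =
      (scal (pow_n x k) (Re (c k)), scal (pow_n x k) (Im (c k)))).
    { intro k; rewrite pow_real; rewrite (pow_n_pow x k).
      unfold scal; simpl; unfold mult; simpl.
      unfold Cmult, RtoC, Re, Im; simpl; f_equal; ring. }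
    intro n; induction n as [|n IH].
    - rewrite 3!sum_O; apply term.
    - rewrite 3!sum_Sn, IH, term; reflexivity. }
  split; unfold is_pseries, is_series in *; intros P [e He].
  - destruct (H (fun z => P (Re z))) as [N HN].
    { exists e; intros y Hy; apply He; apply Hy. }
    exists N; intros n Hn; specialize (HN n Hn); now rewrite sums in HN.
  - destruct (H (fun z => P (Im z))) as [N HN].
    { exists e; intros y Hy; apply He; apply Hy. }
    exists N; intros n Hn; specialize (HN n Hn); now rewrite sums in HN. }
assert (real_unique : forall (u v : nat -> R) (g : R -> R),
  (forall x, Rabs x < 1 -> is_pseries u x (g x)) ->
  (forall x, Rabs x < 1 -> is_pseries v x (g x)) -> forall n, u n = v n).
{ assert (radius : forall (u : nat -> R) g,
    (forall x, Rabs x < 1 -> is_pseries u x (g x)) -> Rbar_lt 0 (CV_radius u)).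
  { intros u g Hu; apply Rbar_lt_le_trans with (/ 2); [simpl; lra|].
    apply Rbar_not_lt_le; intro Hlt.
    apply (CV_disk_outside u (/ 2)).
    - now rewrite Rabs_pos_eq by lra.
    - assert (Hh : Rabs (/ 2) < 1) by (rewrite Rabs_pos_eq; lra).
      apply ex_series_lim_0; exists (g (/ 2)).
      apply is_series_ext with (2 := Hu _ Hh).
      intro n; rewrite pow_n_pow; apply Rmult_comm. }
  intros u v g Hu Hv n.
  apply PSeries_ext_recip; eauto.
  exists (mkposreal 1 Rlt_0_1); intros x Hx.
  assert (Hx' : Rabs x < 1).
  { replace x with (x - 0) by ring; exact Hx. }
  now rewrite (is_pseries_unique _ _ _ (Hu x Hx')),
    (is_pseries_unique _ _ _ (Hv x Hx')). }
intros Ha Hb n.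
assert (HR : Re (a n) = Re (b n)).
{ apply (real_unique (fun n => Re (a n)) (fun n => Re (b n))
    (fun x => Re (f (RtoC x)))); intros x Hx; now apply parts. }
assert (HI : Im (a n) = Im (b n)).
{ apply (real_unique (fun n => Im (a n)) (fun n => Im (b n))
    (fun x => Im (f (RtoC x)))); intros x Hx; now apply parts. }
unfold Re, Im in *; rewrite (surjective_pairing (a n)), (surjective_pairing (b n)).
now rewrite HR, HI.
Qed.

(* Meaningful only when f has an expansion in the disk, in which case the
   sequence is determined by [expansion_unique]. *)
Definition taylor (f : C -> C) : nat -> C :=
  epsilon (inhabits (fun _ : nat => RtoC 0)) (expansion f).

Definition norm_sq (w : nat -> R) (f : C -> C) : R :=
  Series (fun n => Cmod (taylor f n) ^ 2 * w n).

Definition in_H2 (w : nat -> R) (f : C -> C) : Prop :=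
  (exists a, expansion f a) /\
  ex_series (fun n => Cmod (taylor f n) ^ 2 * w n).

Definition CSeries (a : nat -> C) : C :=
  (Series (fun n => Re (a n)), Series (fun n => Im (a n))).

Definition inner (w : nat -> R) (f g : C -> C) : C :=
  CSeries (fun n => taylor f n * Cconj (taylor g n) * RtoC (w n))%C.

Definition nonzero_on_disk (f : C -> C) : Prop :=
  exists z : C, Cmod z < 1 /\ f z <> RtoC 0.

Definition shift (f : C -> C) : C -> C := fun z => (z * f z)%C.

Definition quotient (w : nat -> R) (f : C -> C) : R :=
  Cmod (inner w f (shift f)) / norm_sq w (shift f).

Definition U (w : nat -> R) : Rbar :=
  Lub_Rbar (fun q : R =>
    exists f : C -> C, in_H2 w f /\ nonzero_on_disk f /\ q = quotient w f).

Definition extremal (w : nat -> R) (f : C -> C) : Prop :=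
  in_H2 w f /\ nonzero_on_disk f /\ Finite (quotient w f) = U w.

(* Main.v *)
Require Import Defs.
From Stdlib Require Import Arith Reals Lra Lia ClassicalEpsilon Classical.
From Coquelicot Require Import Coquelicot.

Open Scope R_scope.

(* With [x_n = |a_n|] the quotient is at most
   [(sum x_(n+1) x_n w_(n+1)) / (sum x_n^2 w_(n+1))], with equality for [a_n = x_n >= 0]; so
   [U w] is the top of the spectrum of a Jacobi matrix. A positive sequence [r] with
   [r_0 <= 2 l] and [r_(n+1) <= 2 l - (w_(n+1) / w_(n+2)) / r_n] shows [U w <= l] (Schur test).
   For (A), take [r] to satisfy these with equality at [l = U w > 1]. If some [r_n <= 0], the
   solution [x_(n+1) = r_n x_n] truncated at [n] attains [l]. Otherwise [r_n] must eventually
   lie below [1 / l], since else a smaller [l] would pass the Schur test; hence [x] decays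
   geometrically, is summable against [w], and attains [l]. The bound [U w > 1] comes from
   the test sequence [x_k = 1/2], [x_(k+1) = ... = x_(k+n) = 1].
   For (B), [r = 1] passes the test with [l = 1], and equality forces [x] to be constant,
   hence zero. *)

(** * Convergence and estimation of series *)

Lemma ex_series_le_pos (a b : nat -> R) :
  (forall n, 0 <= a n <= b n) -> ex_series b -> ex_series a.
Proof.
intros Hab Hb.
apply (@ex_series_le R_AbsRing R_CompleteNormedModule a b); [|exact Hb].
intro n; change (Rabs (a n) <= b n); rewrite Rabs_pos_eq; apply Hab.
Qed.

Lemma is_series_finite (a : nat -> R) (N : nat) :
  (forall n, (N < n)%nat -> a n = 0) -> is_series a (sum_n a N).
Proof.
intro Ha.
assert (E : forall m, sum_n a (N + m) = sum_n a N).
{ induction m as [|m IH]; [now rewrite Nat.add_0_r|].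
  rewrite Nat.add_succ_r, sum_Sn, IH, Ha by lia.
  apply Rplus_0_r. }
intros P HP; exists N; intros n Hn.
replace n with (N + (n - N))%nat by lia.
rewrite E; exact (locally_singleton _ _ HP).
Qed.

Lemma is_series_single (a : nat -> R) (k : nat) :
  (forall n, n <> k -> a n = 0) -> is_series a (a k).
Proof.
intro Ha.
replace (a k) with (sum_n a k); [apply is_series_finite; intros; apply Ha; lia|].
destruct k as [|k]; [apply sum_O|].
rewrite sum_Sn.
replace (sum_n a k) with 0; [apply Rplus_0_l|].
assert (E : forall m, (m <= k)%nat -> sum_n a m = 0).
{ induction m as [|m IH]; intro Hm.
  - rewrite sum_O; apply Ha; lia.
  - rewrite sum_Sn, IH, Ha by lia; apply Rplus_0_l. }
now rewrite E.
Qed.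

Lemma ex_series_ratio (a : nat -> R) (q : R) (N : nat) :
  0 <= q < 1 -> (forall n, 0 <= a n) ->
  (forall n, (N <= n)%nat -> a (S n) <= q * a n) -> ex_series a.
Proof.
intros Hq Ha Hr.
apply ex_series_incr_n with (n := N).
apply ex_series_le_pos with (b := fun n => a N * q ^ n).
- intro n; split; [apply Ha|].
  induction n as [|n IH]; [rewrite Nat.add_0_r; simpl; lra|].
  rewrite Nat.add_succ_r; simpl.
  pose proof (Hr (N + n)%nat ltac:(lia)).
  pose proof (Rmult_le_compat_l q _ _ (proj1 Hq) IH); lra.
- apply (ex_series_scal_l (K := R_AbsRing) (V := R_NormedModule)).
  apply ex_series_geom; rewrite Rabs_pos_eq; lra.
Qed.

(** With [S = p + i q] the sum, [|S|^2] is the sum of [Re (conj S * a_n)], hence at most [|S|] times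
    the sum of [b]; dividing by [|S|] leaves only the case [S = 0]. *)
Lemma CSeries_bound (a : nat -> C) (b : nat -> R) :
  (forall n, Cmod (a n) <= b n) -> ex_series b -> Cmod (CSeries a) <= Series b.
Proof.
intros Hab Hb.
assert (Hpart : forall n, Rabs (Re (a n)) <= b n /\ Rabs (Im (a n)) <= b n).
{ intro n; pose proof (Rmax_Cmod (a n)); pose proof (Hab n).
  pose proof (Rmax_l (Rabs (fst (a n))) (Rabs (snd (a n)))).
  pose proof (Rmax_r (Rabs (fst (a n))) (Rabs (snd (a n)))).
  unfold Re, Im; split; lra. }
assert (ER : ex_series (fun n => Re (a n))).
{ apply (@ex_series_le R_AbsRing R_CompleteNormedModule _ b); [|exact Hb].
  intro n; apply Hpart. }
assert (EI : ex_series (fun n => Im (a n))).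
{ apply (@ex_series_le R_AbsRing R_CompleteNormedModule _ b); [|exact Hb].
  intro n; apply Hpart. }
set (p := Series (fun n => Re (a n))); set (q := Series (fun n => Im (a n))).
assert (Hsq : Cmod (CSeries a) ^ 2 <= Cmod (CSeries a) * Series b).
{ replace (Cmod (CSeries a) ^ 2)
    with (Series (fun n => p * Re (a n) + q * Im (a n))).
  - rewrite <- Series_scal_l.
    apply Rle_trans with (1 := Rle_abs _).
    assert (Hle : forall n, 0 <= Rabs (p * Re (a n) + q * Im (a n))
                  <= Cmod (CSeries a) * b n).
    { intro n; split; [apply Rabs_pos|].
      apply Rle_trans with (Cmod (CSeries a) * Cmod (a n)).
      - apply Rsqr_incr_0_var.
        + rewrite <- Rsqr_abs, Rsqr_mult.
          unfold Cmod, CSeries; fold p q; simpl fst; simpl snd.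
          rewrite 2!Rsqr_sqrt by nra.
          unfold Rsqr, Re, Im.
          (* Lagrange's identity: this square is the gap in the Cauchy-Schwarz inequality for
             [(p, q)] and [a n]. *)
          pose proof (Rle_0_sqr (p * snd (a n) - q * fst (a n))) as H.
          unfold Rsqr in H; nra.
        + apply Rmult_le_pos; apply Cmod_ge_0.
      - apply Rmult_le_compat_l; [apply Cmod_ge_0|apply Hab]. }
    assert (Eb : ex_series (fun n => Cmod (CSeries a) * b n))
      by now apply (ex_series_scal_l (K := R_AbsRing) (V := R_NormedModule)).
    eapply Rle_trans; [apply Series_Rabs|apply Series_le; assumption].
    now apply ex_series_le_pos with (2 := Eb).
  - rewrite Series_plus, 2!Series_scal_l.
    + fold p q; unfold CSeries; fold p q; unfold Cmod; simpl fst; simpl snd.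
      rewrite pow2_sqrt by nra; ring.
    + now apply (ex_series_scal_l (K := R_AbsRing) (V := R_NormedModule)).
    + now apply (ex_series_scal_l (K := R_AbsRing) (V := R_NormedModule)). }
destruct (Cmod_ge_0 (CSeries a)) as [H|H].
- apply Rmult_le_reg_l with (1 := H); lra.
- rewrite <- H.
  replace 0 with (Series (fun _ : nat => 0)).
  + apply Series_le; [|exact Hb]; intro n; split; [lra|].
    apply Rle_trans with (2 := Hab n); apply Cmod_ge_0.
  + apply is_series_unique, (is_series_single (fun _ => 0) 0); reflexivity.
Qed.

(** * Taylor coefficients and functions on the disk *)

Lemma taylor_expansion (f : C -> C) :
  (exists a, expansion f a) -> expansion f (taylor f).
Proof. intro H; exact (epsilon_spec _ _ H). Qed.

Lemma taylor_unique (f : C -> C) (a : nat -> C) :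
  expansion f a -> forall n, taylor f n = a n.
Proof.
intros H n; apply (expansion_unique f); [|exact H].
apply taylor_expansion; now exists a.
Qed.

Lemma taylor_shift (f : C -> C) :
  (exists a, expansion f a) ->
  taylor (shift f) 0 = RtoC 0 /\ forall n, taylor (shift f) (S n) = taylor f n.
Proof.
intros H; apply taylor_expansion in H.
assert (E : expansion (shift f) (PS_incr_1 (taylor f))).
{ intros z Hz; exact (is_pseries_incr_1 (V := C_NormedModule) _ _ _ (H z Hz)). }
split; [|intro n]; now rewrite (taylor_unique _ _ E).
Qed.

Lemma is_pseries_zero (z : C) (a : nat -> C) :
  (forall n, a n = RtoC 0) -> is_pseries a z (RtoC 0).
Proof.
intros Ha.
assert (E : forall n,
  sum_n (fun k => scal (pow_n (z : C_AbsRing) k) (a k : C_NormedModule)) n = RtoC 0).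
{ intro n; induction n as [|n IH].
  - rewrite sum_O, Ha; apply (scal_zero_r (V := C_NormedModule)).
  - rewrite sum_Sn, IH, Ha.
    rewrite (scal_zero_r (V := C_NormedModule)).
    apply (plus_zero_l (G := C_NormedModule)). }
intros P HP; exists 0%nat; intros n _; rewrite E; exact (locally_singleton _ _ HP).
Qed.

Lemma nonzero_on_disk_taylor (f : C -> C) :
  (exists a, expansion f a) -> nonzero_on_disk f ->
  exists n, taylor f n <> RtoC 0.
Proof.
intros H [z [Hz Hf]]; apply not_all_ex_not; intro H0; apply Hf.
apply (filterlim_locally_unique (F := eventually) (V := C_NormedModule)
  (sum_n (fun k => scal (pow_n (z : C_AbsRing) k) (taylor f k : C_NormedModule)))).
- now apply (taylor_expansion f H).
- now apply is_pseries_zero.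
Qed.

Lemma taylor_nonzero_on_disk (f : C -> C) (n : nat) :
  taylor f n <> RtoC 0 -> nonzero_on_disk f.
Proof.
intro Hn; apply NNPP; intro H; apply Hn.
apply (taylor_unique f (fun _ => RtoC 0)).
intros z Hz; replace (f z) with (RtoC 0); [now apply is_pseries_zero|].
apply NNPP; intro Hf; apply H; exists z; auto.
Qed.

Lemma Cmod_pow_n (z : C) (n : nat) : Cmod (pow_n (z : C_AbsRing) n) = Cmod z ^ n.
Proof.
induction n as [|n IH]; simpl; [apply Cmod_1|].
change (Cmod (z * pow_n (z : C_AbsRing) n)%C = Cmod z * Cmod z ^ n).
now rewrite Cmod_mult, IH.
Qed.

Lemma expansion_exists (a : nat -> C) :
  (forall q, 0 < q < 1 -> ex_series (fun n => Cmod (a n) * q ^ n)) ->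
  exists f, expansion f a.
Proof.
intro H.
exists (fun z => epsilon (inhabits (RtoC 0)) (fun l => is_pseries a z l)).
intros z Hz; apply epsilon_spec.
(* The radius [(|z| + 1) / 2] lies between [|z|] and 1 and stays positive at [z = 0], as [H]
   demands. *)
apply (@ex_series_le C_AbsRing C_CompleteNormedModule _
  (fun n => Cmod (a n) * ((Cmod z + 1) / 2) ^ n)).
- intro n.
  change (Cmod (pow_n (z : C_AbsRing) n * a n)%C <= Cmod (a n) * ((Cmod z + 1) / 2) ^ n).
  rewrite Cmod_mult, Cmod_pow_n, Rmult_comm.
  apply Rmult_le_compat_l; [apply Cmod_ge_0|].
  apply pow_incr; pose proof (Cmod_ge_0 z); lra.
- apply H; pose proof (Cmod_ge_0 z); lra.
Qed.

(** * Sequences of coefficient moduli *)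

(** The coefficient [a_n] of [f] sits at degree [n + 1] in [zf], whence the weight [w (S n)] both
    here and in [den]. *)
Definition num (w x : nat -> R) : R := Series (fun n => x (S n) * x n * w (S n)).

Definition den (w x : nat -> R) : R := Series (fun n => x n ^ 2 * w (S n)).

Definition admissible (w x : nat -> R) : Prop :=
  (forall n, 0 <= x n) /\ ex_series (fun n => x n ^ 2 * w n).

Lemma ex_series_finite (a : nat -> R) (N : nat) :
  (forall n, (N < n)%nat -> a n = 0) -> ex_series a.
Proof. intro H; eexists; now apply is_series_finite with (N := N). Qed.

(** * Growth of the weights *)

Lemma eventually_ratio_le (w : nat -> R) (q : R) :
  is_lim_seq (fun n => w n / w (S n)) 1 -> 1 < q ->
  exists N, forall n, (N <= n)%nat -> w n / w (S n) <= q.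
Proof.
intros H Hq; apply is_lim_seq_spec in H.
destruct (H (mkposreal (q - 1) ltac:(lra))) as [N HN]; exists N; intros n Hn.
specialize (HN n Hn); simpl in HN; apply Rabs_def2 in HN; lra.
Qed.

Lemma eventually_succ_le (w : nat -> R) (q : R) :
  (forall n, 0 < w n) -> is_lim_seq (fun n => w n / w (S n)) 1 -> 1 < q ->
  exists N, forall n, (N <= n)%nat -> w (S n) <= q * w n.
Proof.
intros Hw H Hq; apply is_lim_seq_spec in H.
assert (H1 : 0 < 1 - / q) by (apply Rlt_0_minus; rewrite <- Rinv_1; apply Rinv_lt_contravar; lra).
destruct (H (mkposreal _ H1)) as [N HN]; exists N; intros n Hn.
specialize (HN n Hn); simpl in HN; apply Rabs_def2 in HN.
assert (H2 : / q < w n / w (S n)) by lra.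
apply (Rmult_lt_compat_r (q * w (S n))) in H2; [|apply Rmult_lt_0_compat; [lra|apply Hw]].
pose proof (Hw (S n)).
replace (/ q * (q * w (S n))) with (w (S n)) in H2 by (field; lra).
replace (w n / w (S n) * (q * w (S n))) with (q * w n) in H2 by (field; lra).
lra.
Qed.

Lemma eventually_bounded (u : nat -> R) (N : nat) (q : R) :
  (forall n, (N <= n)%nat -> u n <= q) ->
  exists K, 0 < K /\ forall n, u n <= K.
Proof.
revert u; induction N as [|N IH]; intros u H.
- exists (Rmax 1 q); split; [pose proof (Rmax_l 1 q); lra|].
  intro n; apply Rle_trans with (2 := Rmax_r 1 q); apply H; lia.
- destruct (IH (fun n => u (S n))) as [K [HK Hu]]; [intros n Hn; apply H; lia|].
  exists (Rmax K (u 0%nat)); split; [pose proof (Rmax_l K (u 0%nat)); lra|].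
  intros [|n]; [apply Rmax_r|apply Rle_trans with (1 := Hu n), Rmax_l].
Qed.

Lemma ratio_bounded (w : nat -> R) :
  is_lim_seq (fun n => w n / w (S n)) 1 ->
  exists K, 0 < K /\ forall n, w n / w (S n) <= K.
Proof.
intro H; destruct (eventually_ratio_le w 2 H ltac:(lra)) as [N HN].
now apply eventually_bounded with (1 := HN).
Qed.

Lemma succ_bounded (w : nat -> R) :
  (forall n, 0 < w n) -> is_lim_seq (fun n => w n / w (S n)) 1 ->
  exists K, 0 < K /\ forall n, w (S n) <= K * w n.
Proof.
intros Hw H; destruct (eventually_succ_le w 2 Hw H ltac:(lra)) as [N HN].
destruct (eventually_bounded (fun n => w (S n) / w n) N 2) as [K [HK Hu]].
- intros n Hn; apply Rle_div_l; [apply Hw|now apply HN].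
- exists K; split; [exact HK|]; intro n; apply Rle_div_l; [apply Hw|apply Hu].
Qed.

(** * The quotient in terms of nonnegative sequences *)

(** Multiplication by [z] is bounded, because [w_(n+1) / w_n] is. *)
Lemma admissible_den (w x : nat -> R) :
  (forall n, 0 < w n) -> is_lim_seq (fun n => w n / w (S n)) 1 ->
  admissible w x -> ex_series (fun n => x n ^ 2 * w (S n)).
Proof.
intros Hw Hl [Hx Hs]; destruct (succ_bounded w Hw Hl) as [K [HK HwK]].
apply ex_series_le_pos with (fun n => K * (x n ^ 2 * w n)).
- intro n; pose proof (HwK n); pose proof (Hw (S n)); pose proof (pow2_ge_0 (x n)).
  split; nra.
- now apply (ex_series_scal_l (K := R_AbsRing) (V := R_NormedModule)).
Qed.

Lemma admissible_num (w x : nat -> R) :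
  (forall n, 0 < w n) -> is_lim_seq (fun n => w n / w (S n)) 1 ->
  admissible w x -> ex_series (fun n => x (S n) * x n * w (S n)).
Proof.
intros Hw Hl Hxw; pose proof (admissible_den w x Hw Hl Hxw) as Hd.
destruct Hxw as [Hx Hs].
apply ex_series_le_pos with (fun n => x (S n) ^ 2 * w (S n) + x n ^ 2 * w (S n)).
- intro n; pose proof (Hw (S n)); pose proof (Hx n); pose proof (Hx (S n)).
  assert (0 <= x (S n) * x n) by now apply Rmult_le_pos.
  split; [now apply Rmult_le_pos; [|lra]|].
  rewrite <- Rmult_plus_distr_r; apply Rmult_le_compat_r; nra.
- apply (ex_series_plus (K := R_AbsRing) (V := R_NormedModule)); [|exact Hd].
  now apply (ex_series_incr_1 (K := R_AbsRing) (V := R_NormedModule)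
    (fun n => x n ^ 2 * w n)).
Qed.

Lemma Series_term_le (a : nat -> R) (n : nat) :
  (forall k, 0 <= a k) -> ex_series a -> a n <= Series a.
Proof.
intros Ha Hs.
replace (a n) with (Series (fun k => if Nat.eq_dec k n then a k else 0)).
- apply Series_le; [|exact Hs]; intro k; pose proof (Ha k).
  destruct (Nat.eq_dec k n); lra.
- apply is_series_unique.
  pose proof (is_series_single (fun k => if Nat.eq_dec k n then a k else 0) n) as E.
  simpl in E; destruct (Nat.eq_dec n n); [|easy].
  apply E; intros k Hk; now destruct (Nat.eq_dec k n).
Qed.

Lemma den_pos (w x : nat -> R) (n : nat) :
  (forall n, 0 < w n) -> is_lim_seq (fun n => w n / w (S n)) 1 ->
  admissible w x -> x n <> 0 -> 0 < den w x.
Proof.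
intros Hw Hl Hxw Hn.
apply Rlt_le_trans with (x n ^ 2 * w (S n)).
- apply Rmult_lt_0_compat; [|apply Hw]; now apply pow2_gt_0.
- apply (Series_term_le (fun n => x n ^ 2 * w (S n)));
    [|now apply admissible_den].
  intro k; apply Rmult_le_pos; [apply pow2_ge_0|apply Rlt_le, Hw].
Qed.

Lemma norm_sq_shift (w : nat -> R) (f : C -> C) :
  (exists a, expansion f a) ->
  norm_sq w (shift f) = den w (fun n => Cmod (taylor f n)).
Proof.
intro H; destruct (taylor_shift f H) as [H0 HS].
unfold norm_sq, den; rewrite Series_incr_1_aux.
- apply Series_ext; intro n; now rewrite HS.
- rewrite H0, Cmod_0; ring.
Qed.

(** Replacing coefficients by their moduli keeps the denominator and, by the triangle inequality,
    can only enlarge the numerator. *)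
Lemma quotient_le (w : nat -> R) (f : C -> C) :
  (forall n, 0 < w n) -> is_lim_seq (fun n => w n / w (S n)) 1 ->
  in_H2 w f -> nonzero_on_disk f ->
  let x := fun n => Cmod (taylor f n) in
  admissible w x /\ (exists n, x n <> 0) /\ quotient w f <= num w x / den w x.
Proof.
intros Hw Hl [He Hs] Hnz x.
assert (Hx : admissible w x) by (split; [intro; apply Cmod_ge_0|exact Hs]).
destruct (nonzero_on_disk_taylor f He Hnz) as [m Hm].
assert (Hxm : x m <> 0) by (pose proof (Cmod_gt_0 (taylor f m)); unfold x; intuition lra).
split; [exact Hx|split; [now exists m|]].
unfold quotient; rewrite norm_sq_shift by exact He; fold x.
apply Rmult_le_compat_r; [now apply Rlt_le, Rinv_0_lt_compat, (den_pos w x m)|].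
destruct (taylor_shift f He) as [H0 HS].
replace (num w x) with
  (Series (fun n => Cmod (taylor f n * Cconj (taylor (shift f) n) * RtoC (w n))%C)).
- apply CSeries_bound; [intro; apply Rle_refl|].
  apply ex_series_incr_1, ex_series_ext with (2 := admissible_num w x Hw Hl Hx).
  intro n; rewrite HS, 2!Cmod_mult, Cmod_conj, Cmod_R, Rabs_pos_eq by apply Rlt_le, Hw.
  reflexivity.
- unfold num; rewrite Series_incr_1_aux.
  + apply Series_ext; intro n.
    rewrite HS, 2!Cmod_mult, Cmod_conj, Cmod_R, Rabs_pos_eq by apply Rlt_le, Hw.
    reflexivity.
  + rewrite H0, 2!Cmod_mult, Cmod_conj, Cmod_0; ring.
Qed.

(** The equality case of [quotient_le]: with coefficients [x_n >= 0] every term of the inner product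
    is nonnegative. The power series converges in the disk because [1 / w_n] grows more slowly than
    any geometric sequence of ratio above 1. *)
Lemma admissible_realized (w x : nat -> R) (m : nat) :
  (forall n, 0 < w n) -> is_lim_seq (fun n => w n / w (S n)) 1 ->
  admissible w x -> x m <> 0 ->
  exists f, in_H2 w f /\ nonzero_on_disk f /\ quotient w f = num w x / den w x.
Proof.
intros Hw Hl Hxw Hm; pose proof Hxw as [Hx Hs].
assert (Hc : forall n, Cmod (RtoC (x n)) = x n)
  by (intro n; rewrite Cmod_R; now apply Rabs_pos_eq).
destruct (expansion_exists (fun n => RtoC (x n))) as [f Hf].
{ intros q Hq.
  (* AM-GM: [x_n q^n <= x_n^2 w_n + q^(2n) / w_n] *)
  apply ex_series_le_pos with (fun n => x n ^ 2 * w n + q ^ n * q ^ n / w n).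
  - intro n; rewrite Hc; pose proof (Hx n); pose proof (pow_le q n (Rlt_le _ _ (proj1 Hq))).
    split; [now apply Rmult_le_pos|].
    pose proof (Hw n) as Hwn.
    assert (E : 0 <= (x n * w n - q ^ n) ^ 2 / w n)
      by (apply Rmult_le_pos; [apply pow2_ge_0|now apply Rlt_le, Rinv_0_lt_compat]).
    replace ((x n * w n - q ^ n) ^ 2 / w n) with
      (x n ^ 2 * w n + q ^ n * q ^ n / w n - 2 * (x n * q ^ n)) in E by (field; lra).
    assert (0 <= x n * q ^ n) by now apply Rmult_le_pos.
    lra.
  - apply (ex_series_plus (K := R_AbsRing) (V := R_NormedModule)); [exact Hs|].
    (* The ratio of consecutive terms [q^(2n) / w_n] is [q^2 w_n / w_(n+1)], eventually at most
       [q^2 / q = q]. *)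
    assert (Hq1 : 1 < / q) by (rewrite <- Rinv_1; apply Rinv_lt_contravar; lra).
    destruct (eventually_ratio_le w (/ q) Hl Hq1) as [N HN].
    assert (Hpos : forall n, 0 <= q ^ n * q ^ n / w n).
    { intro n; pose proof (pow_le q n (Rlt_le _ _ (proj1 Hq))).
      apply Rmult_le_pos; [now apply Rmult_le_pos|apply Rlt_le, Rinv_0_lt_compat, Hw]. }
    apply ex_series_ratio with q N; [lra|exact Hpos|].
    intros n Hn.
    pose proof (Hw n); pose proof (Hw (S n)).
    replace (q ^ S n * q ^ S n / w (S n)) with
      ((q * q * (q ^ n * q ^ n / w n)) * (w n / w (S n))) by (simpl; field; lra).
    replace (q * (q ^ n * q ^ n / w n)) with
      ((q * q * (q ^ n * q ^ n / w n)) * / q)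
      by (field; lra).
    apply Rmult_le_compat_l; [|now apply HN].
    apply Rmult_le_pos; [nra|apply Hpos]. }
assert (Ht := taylor_unique f _ Hf); simpl in Ht.
assert (He : exists a, expansion f a) by (eexists; exact Hf).
exists f; split; [split; [exact He|]|split].
- apply ex_series_ext with (2 := Hs); intro n; now rewrite Ht, Hc.
- apply taylor_nonzero_on_disk with m; rewrite Ht; intro E.
  apply Hm; now apply RtoC_inj.
- unfold quotient; rewrite norm_sq_shift by exact He.
  replace (den w (fun n => Cmod (taylor f n))) with (den w x)
    by (apply Series_ext; intro n; now rewrite Ht, Hc).
  f_equal.
  destruct (taylor_shift f He) as [H0 HS].
  replace (inner w f (shift f)) with (RtoC (num w x)).
  { rewrite Cmod_R; apply Rabs_pos_eq.
    apply Rle_trans with (x 1%nat * x 0%nat * w 1%nat).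
    - apply Rmult_le_pos; [now apply Rmult_le_pos|apply Rlt_le, Hw].
    - apply (Series_term_le (fun n => x (S n) * x n * w (S n)));
        [|now apply admissible_num].
      intro k; apply Rmult_le_pos; [now apply Rmult_le_pos|apply Rlt_le, Hw]. }
  unfold inner, CSeries, RtoC at 1; f_equal.
  + symmetry; unfold num; rewrite Series_incr_1_aux.
    * apply Series_ext; intro n; rewrite HS, 2!Ht; unfold Re; simpl; ring.
    * rewrite H0; unfold Re; simpl; ring.
  + symmetry; apply is_series_unique.
    replace 0 with ((fun _ : nat => 0) 0%nat) at 1 by reflexivity.
    apply is_series_ext with (fun _ : nat => 0);
      [|apply (is_series_single (fun _ => 0) 0%nat); reflexivity].
    intros [|n]; [rewrite H0|rewrite HS, 2!Ht]; unfold Im; simpl; ring.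
Qed.

(** * Bounding and attaining the supremum by sequences *)

Lemma U_le (w : nat -> R) (l : R) :
  (forall n, 0 < w n) -> is_lim_seq (fun n => w n / w (S n)) 1 ->
  (forall x, admissible w x -> num w x <= l * den w x) -> Rbar_le (U w) l.
Proof.
intros Hw Hl H; apply (proj2 (Lub_Rbar_correct _)).
intros q [f [Hf [Hnz ->]]].
destruct (quotient_le w f Hw Hl Hf Hnz) as [Hx [[m Hm] Hq]].
apply Rle_trans with (1 := Hq), Rle_div_l; [now apply (den_pos w _ m)|auto].
Qed.

Lemma U_ge (w x : nat -> R) (m : nat) :
  (forall n, 0 < w n) -> is_lim_seq (fun n => w n / w (S n)) 1 ->
  admissible w x -> x m <> 0 -> Rbar_le (num w x / den w x) (U w).
Proof.
intros Hw Hl Hx Hm; apply (proj1 (Lub_Rbar_correct _)).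
destruct (admissible_realized w x m Hw Hl Hx Hm) as [f [Hf [Hnz Hq]]].
exists f; auto.
Qed.

(** One inequality is enough to attain [l], as [U_ge] supplies the other. *)
Lemma extremal_exists (w x : nat -> R) (m : nat) (l : R) :
  (forall n, 0 < w n) -> is_lim_seq (fun n => w n / w (S n)) 1 ->
  admissible w x -> x m <> 0 -> U w = Finite l -> l * den w x <= num w x ->
  exists f, extremal w f.
Proof.
intros Hw Hl Hx Hm HU Hle.
pose proof (U_ge w x m Hw Hl Hx Hm) as Hge; rewrite HU in Hge; simpl in Hge.
destruct (admissible_realized w x m Hw Hl Hx Hm) as [f [Hf [Hnz Hq]]].
exists f; split; [exact Hf|split; [exact Hnz|]].
rewrite HU, Hq; f_equal; apply Rle_antisym; [exact Hge|].
apply Rle_div_r; [now apply (den_pos w x m)|exact Hle].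
Qed.

(** * The Schur test *)

Lemma sum_n_succ (a : nat -> R) (N : nat) : sum_n a (S N) = sum_n a N + a (S N).
Proof. exact (sum_Sn a N). Qed.

(* Sums of the AM-GM inequalities [2 x_n x_(n+1) <= r_n x_n^2 + x_(n+1)^2 / r_n], keeping the defects. *)
Lemma schur_partial (w x r : nat -> R) (l : R) :
  (forall n, 0 < w n) -> (forall n, 0 < r n) -> r 0%nat <= 2 * l ->
  (forall n, r (S n) <= 2 * l - w (S n) / w (S (S n)) / r n) ->
  forall N,
    sum_n (fun n => x (S n) * x n * w (S n)
                    + w (S n) * (x (S n) - r n * x n) ^ 2 / (2 * r n)) N
    <= l * sum_n (fun n => x n ^ 2 * w (S n)) (S N)
       - r (S N) * x (S N) ^ 2 * w (S (S N)) / 2.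
Proof.
intros Hw Hr H0 HS.
(* In the sum, [x_(n+1)^2] receives [r_(n+1)] from one AM-GM inequality and [1 / r_n] from the
   previous one; the condition on [r] says that together they cost at most [2 l]. *)
assert (Hstep : forall n, r (S n) * x (S n) ^ 2 * w (S (S n))
  <= 2 * l * x (S n) ^ 2 * w (S (S n)) - x (S n) ^ 2 * w (S n) / r n).
{ intro n; pose proof (Hw (S (S n))); pose proof (Hr n).
  replace (2 * l * x (S n) ^ 2 * w (S (S n)) - x (S n) ^ 2 * w (S n) / r n)
    with ((2 * l - w (S n) / w (S (S n)) / r n) * (x (S n) ^ 2 * w (S (S n))))
    by (field; lra).
  rewrite Rmult_assoc; apply Rmult_le_compat_r; [|apply HS].
  apply Rmult_le_pos; [apply pow2_ge_0|lra]. }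
assert (Hsq : forall n, x (S n) * x n * w (S n)
    + w (S n) * (x (S n) - r n * x n) ^ 2 / (2 * r n)
  = r n * x n ^ 2 * w (S n) / 2 + x (S n) ^ 2 * w (S n) / r n / 2).
{ intro n; pose proof (Hr n); field; lra. }
induction N as [|N IH].
- rewrite sum_n_succ, 2!sum_O, Hsq.
  pose proof (Hstep 0%nat).
  assert (r 0%nat * (x 0%nat ^ 2 * w 1%nat) <= 2 * l * (x 0%nat ^ 2 * w 1%nat)).
  { apply Rmult_le_compat_r; [|exact H0].
    apply Rmult_le_pos; [apply pow2_ge_0|apply Rlt_le, Hw]. }
  lra.
- rewrite sum_n_succ, (sum_n_succ _ (S N)), Hsq.
  pose proof (Hstep (S N)).
  lra.
Qed.

Lemma sum_n_term_le (a : nat -> R) (m N : nat) :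
  (forall k, 0 <= a k) -> (m <= N)%nat -> a m <= sum_n a N.
Proof.
intros Ha; induction N as [|N IH]; intro Hm.
- replace m with 0%nat by lia; rewrite sum_O; lra.
- rewrite sum_n_succ.
  destruct (Nat.eq_dec m (S N)) as [->|Hne].
  + assert (0 <= sum_n a N); [|lra].
    rewrite sum_n_Reals; now apply cond_pos_sum.
  + pose proof (IH ltac:(lia)); pose proof (Ha (S N)); lra.
Qed.

(** The limit of [schur_partial], whose boundary term and defects are nonnegative. One arbitrary
    defect is kept, so that equality forces [x_(m+1) = r_m x_m] for every [m]. *)
Lemma schur (w x r : nat -> R) (l : R) :
  (forall n, 0 < w n) -> is_lim_seq (fun n => w n / w (S n)) 1 ->
  (forall n, 0 < r n) -> r 0%nat <= 2 * l ->
  (forall n, r (S n) <= 2 * l - w (S n) / w (S (S n)) / r n) ->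
  admissible w x ->
  forall m, num w x + w (S m) * (x (S m) - r m * x m) ^ 2 / (2 * r m)
            <= l * den w x.
Proof.
intros Hw Hl Hr H0 HS Hx m.
set (e := fun n => w (S n) * (x (S n) - r n * x n) ^ 2 / (2 * r n)).
change (num w x + e m <= l * den w x).
assert (He : forall n, 0 <= e n).
{ intro n; pose proof (Hr n); apply Rmult_le_pos.
  - apply Rmult_le_pos; [apply Rlt_le, Hw|apply pow2_ge_0].
  - apply Rlt_le, Rinv_0_lt_compat; lra. }
apply (is_lim_seq_le_loc
  (fun N => sum_n (fun n => x (S n) * x n * w (S n)) N + e m)
  (fun N => l * sum_n (fun n => x n ^ 2 * w (S n)) (S N))
  (num w x + e m) (l * den w x)).
- exists m; intros N HN.
  pose proof (schur_partial w x r l Hw Hr H0 HS N) as H.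
  rewrite (sum_n_plus (fun n => x (S n) * x n * w (S n)) e) in H.
  pose proof (sum_n_term_le e m N He HN).
  assert (0 <= r (S N) * x (S N) ^ 2 * w (S (S N))).
  { pose proof (Hr (S N)); pose proof (Hw (S (S N))).
    apply Rmult_le_pos; [apply Rmult_le_pos; [lra|apply pow2_ge_0]|lra]. }
  change plus with Rplus in H; lra.
- apply is_lim_seq_plus'; [|apply is_lim_seq_const].
  exact (Series_correct _ (admissible_num w x Hw Hl Hx)).
- apply (is_lim_seq_scal_l _ l (den w x)).
  apply (is_lim_seq_incr_1 (sum_n (fun n => x n ^ 2 * w (S n)))).
  exact (Series_correct _ (admissible_den w x Hw Hl Hx)).
Qed.

Lemma schur_le (w x r : nat -> R) (l : R) :
  (forall n, 0 < w n) -> is_lim_seq (fun n => w n / w (S n)) 1 ->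
  (forall n, 0 < r n) -> r 0%nat <= 2 * l ->
  (forall n, r (S n) <= 2 * l - w (S n) / w (S (S n)) / r n) ->
  admissible w x -> num w x <= l * den w x.
Proof.
intros Hw Hl Hr H0 HS Hx.
pose proof (schur w x r l Hw Hl Hr H0 HS Hx 0).
assert (0 <= w 1%nat * (x 1%nat - r 0%nat * x 0%nat) ^ 2 / (2 * r 0%nat)); [|lra].
pose proof (Hr 0%nat); apply Rmult_le_pos.
- apply Rmult_le_pos; [apply Rlt_le, Hw|apply pow2_ge_0].
- apply Rlt_le, Rinv_0_lt_compat; lra.
Qed.

(** If [K] bounds [w_n / w_(n+1)], then [r = 1] passes the Schur test with [2 l = 1 + K]. The
    sequence [1, 0, 0, ...] excludes the value minus infinity. *)
Lemma U_finite (w : nat -> R) :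
  (forall n, 0 < w n) -> is_lim_seq (fun n => w n / w (S n)) 1 ->
  exists u, U w = Finite u.
Proof.
intros Hw Hl; destruct (ratio_bounded w Hl) as [K [HK HwK]].
assert (Hle : Rbar_le (U w) ((1 + K) / 2)).
{ apply U_le; [exact Hw|exact Hl|]; intros x Hx.
  apply schur_le with (fun _ => 1); auto; try (intros; lra).
  intro n; pose proof (HwK (S n)); lra. }
assert (Hge : Rbar_le (num w (fun n => match n with 0%nat => 1 | _ => 0 end)
  / den w (fun n => match n with 0%nat => 1 | _ => 0 end)) (U w)).
{ apply U_ge with 0%nat; [exact Hw|exact Hl| |lra].
  split; [intros [|n]; lra|].
  apply ex_series_finite with 0%nat; intros [|n] Hn; [lia|ring]. }
destruct (U w) as [u| |]; [now exists u|easy|easy].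
Qed.

(** * The Euler-Lagrange recurrence and its ratios *)

(** Along a solution the AM-GM inequalities are equalities and the sum telescopes to a boundary
    term. Since [x (S N)] is left free, this covers both a solution that continues,
    [x_(N+1) = r_N x_N], and one cut off at [N], [x_(N+1) = 0]. *)
Lemma ground_sum (w x r : nat -> R) (l : R) (N : nat) :
  (forall n, 0 < w n) -> r 0%nat = 2 * l ->
  (forall n, r (S n) = 2 * l - w (S n) / w (S (S n)) / r n) ->
  (forall n, (n < N)%nat -> 0 < r n /\ x (S n) = r n * x n) ->
  r N * x N ^ 2 * w (S N) / 2 - x (S N) * x N * w (S N)
  = sum_n (fun n => l * (x n ^ 2 * w (S n)) - x (S n) * x n * w (S n)) N.
Proof.
intros Hw H0 HS; induction N as [|N IH]; intro Hx.
- rewrite sum_O, H0; field.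
- rewrite sum_n_succ, <- IH by (intros; apply Hx; lia).
  destruct (Hx N ltac:(lia)) as [Hr Hxr].
  pose proof (Hw (S (S N))).
  rewrite HS; rewrite Hxr; field; lra.
Qed.

Lemma Series_num_den (w x : nat -> R) (l : R) :
  (forall n, 0 < w n) -> is_lim_seq (fun n => w n / w (S n)) 1 ->
  admissible w x ->
  is_series (fun n => l * (x n ^ 2 * w (S n)) - x (S n) * x n * w (S n))
    (l * den w x - num w x).
Proof.
intros Hw Hl Hx.
apply (is_series_minus (K := R_AbsRing) (V := R_NormedModule)).
- apply (is_series_scal_l (K := R_AbsRing) (V := R_NormedModule)).
  exact (Series_correct _ (admissible_den w x Hw Hl Hx)).
- exact (Series_correct _ (admissible_num w x Hw Hl Hx)).
Qed.

(* [ratio w l n = x_(n+1) / x_n] for the solution of the Euler-Lagrange recurrence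
   [x_(n+1) w_(n+1) + x_(n-1) w_n = 2 l x_n w_(n+1)]. *)
Fixpoint ratio (w : nat -> R) (l : R) (n : nat) : R :=
  match n with
  | 0%nat => 2 * l
  | S m => 2 * l - w (S m) / w (S (S m)) / ratio w l m
  end.

(** The solution normalized by [x_0 = 1]; below it is used only at indices where all earlier ratios
    are positive. *)
Fixpoint ground (w : nat -> R) (l : R) (n : nat) : R :=
  match n with
  | 0%nat => 1
  | S m => ratio w l m * ground w l m
  end.

Lemma ground_pos (w : nat -> R) (l : R) (n : nat) :
  (forall j, (j < n)%nat -> 0 < ratio w l j) -> 0 < ground w l n.
Proof.
induction n as [|n IH]; intro H; simpl; [lra|].
apply Rmult_lt_0_compat; [apply H; lia|apply IH; intros; apply H; lia].
Qed.

Lemma ratio_continuous (w : nat -> R) (l : R) (n : nat) :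
  (forall j, (j < n)%nat -> 0 < ratio w l j) ->
  continuity_pt (fun t => ratio w t n) l.
Proof.
induction n as [|n IH]; intro H; simpl; [reg|].
apply continuity_pt_minus; [reg|].
apply (continuity_pt_div (fun _ => w (S n) / w (S (S n)))).
- apply continuity_pt_const; now intros ? ?.
- apply IH; intros; apply H; lia.
- pose proof (H n ltac:(lia)); lra.
Qed.

Lemma ratio_gt_locally (w : nat -> R) (l a : R) (n : nat) :
  (forall j, (j < n)%nat -> 0 < ratio w l j) -> a < ratio w l n ->
  locally l (fun t => a < ratio w t n).
Proof.
intros H Ha.
apply (proj1 (continuity_pt_filterlim _ _) (ratio_continuous w l n H)
  (fun y => a < y)).
now apply (open_gt a).
Qed.

Lemma ratio_pos_locally (w : nat -> R) (l : R) (n : nat) :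
  (forall j, (j < n)%nat -> 0 < ratio w l j) ->
  locally l (fun t => forall j, (j < n)%nat -> 0 < ratio w t j).
Proof.
induction n as [|n IH]; intro H.
- apply filter_forall; intros; lia.
- assert (Hn : forall j, (j < n)%nat -> 0 < ratio w l j) by (intros; apply H; lia).
  generalize (filter_and _ _ (IH Hn) (ratio_gt_locally w l 0 n Hn (H n ltac:(lia)))).
  apply filter_imp; intros t [H1 H2] j Hj.
  destruct (Nat.eq_dec j n) as [->|]; [exact H2|apply H1; lia].
Qed.

(* If the ratios at [u = U w] did not fall below [/ u], then by continuity they would still
   be above it up to [N] for some smaller parameter [t], and continuing with the constant [/ u]
   would give a Schur test for [t < U w]. *)
Lemma ratio_eventually_small (w : nat -> R) (u : R) :
  (forall n, 0 < w n) -> is_lim_seq (fun n => w n / w (S n)) 1 ->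
  U w = Finite u -> 1 < u -> (forall n, 0 < ratio w u n) ->
  exists N, forall n, (N <= n)%nat -> ratio w u n <= / u.
Proof.
intros Hw Hl HU Hu Hr.
assert (Hiu : 0 < / u < 1).
{ split; [apply Rinv_0_lt_compat; lra|].
  rewrite <- Rinv_1; apply Rinv_lt_contravar; lra. }
assert (Huu : / u * u = 1) by (field; lra).
(* The constant tail [/ u] passes the Schur test for [t] if [/ u <= 2 t - m u], that is [t >= b] for
   the [b] set below, where [m] bounds the weight ratios. Then [b < u] means [m < 2 - / u ^ 2], and
   [m] is chosen midway between 1 and this bound. *)
set (m := (3 - / u ^ 2) / 2).
assert (Hiu2 : / u ^ 2 = / u * / u) by (field; lra).
assert (Hm : 1 < m) by (unfold m; rewrite Hiu2; nra).
destruct (eventually_ratio_le w m Hl Hm) as [N HN].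
exists N; intros n Hn; apply Rnot_lt_le; intro Hgt.
set (b := (m * u + / u) / 2).
assert (Hb : b < u).
{ assert (m * u = (3 * u - / u) / 2) by (unfold m; rewrite Hiu2; nra).
  unfold b; nra. }
destruct (filter_and _ _ (ratio_pos_locally w u n (fun j _ => Hr j))
  (ratio_gt_locally w u (/ u) n (fun j _ => Hr j) Hgt)) as [e He].
set (t := Rmax b (u - e / 2)).
pose proof (cond_pos e) as Hepos.
assert (Ht : b <= t < u /\ u - e / 2 <= t).
{ split; [split; [apply Rmax_l|apply Rmax_lub_lt; lra]|apply Rmax_r]. }
destruct (He t) as [Hpos Htn].
{ change (Rabs (t - u) < e); apply Rabs_def1; lra. }
assert (Hlt : Rbar_le (U w) t).
{ apply U_le; [exact Hw|exact Hl|]; intros x Hx.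
  apply schur_le with (fun k => if le_dec k n then ratio w t k else / u);
    [exact Hw|exact Hl| | | |exact Hx].
  - intro k; destruct (le_dec k n); [|lra].
    destruct (Nat.eq_dec k n) as [->|]; [lra|apply Hpos; lia].
  - destruct (le_dec 0 n); [simpl; lra|lia].
  - intro k.
    (* The general [y] serves both the passage from [ratio w t n] to the tail and the tail
       itself. *)
    assert (Htail : (n <= k)%nat -> forall y, / u <= y ->
      / u <= 2 * t - w (S k) / w (S (S k)) / y).
    { intros Hk y Hy.
      assert (w (S k) / w (S (S k)) / y <= m * u); [|unfold b in Ht; lra].
      apply Rmult_le_compat.
      - apply Rlt_le, Rdiv_lt_0_compat; apply Hw.
      - apply Rlt_le, Rinv_0_lt_compat; lra.
      - apply HN; lia.
      - rewrite <- (Rinv_inv u); apply Rinv_le_contravar; lra. }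
    destruct (le_dec (S k) n), (le_dec k n); try lia.
    + simpl; lra.
    + replace k with n in * by lia; apply Htail; [lia|lra].
    + apply Htail; [lia|lra]. }
rewrite HU in Hlt; simpl in Hlt; lra.
Qed.

(** The terms [x_n^2 w_n] eventually shrink by [q^2 * (1 / q) = q] at each step, as
    [w_(n+1) <= w_n / q] for large [n]. *)
Lemma ground_admissible (w : nat -> R) (l q : R) (N : nat) :
  (forall n, 0 < w n) -> is_lim_seq (fun n => w n / w (S n)) 1 ->
  0 < q < 1 -> (forall n, 0 < ratio w l n) ->
  (forall n, (N <= n)%nat -> ratio w l n <= q) ->
  admissible w (ground w l).
Proof.
intros Hw Hl Hq Hr HN.
assert (Hx : forall n, 0 < ground w l n) by (intro; now apply ground_pos).
split; [intro n; now apply Rlt_le|].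
assert (Hq1 : 1 < / q) by (rewrite <- Rinv_1; apply Rinv_lt_contravar; lra).
destruct (eventually_succ_le w (/ q) Hw Hl Hq1) as [M HM].
apply ex_series_ratio with q (Nat.max N M); [lra| |].
- intro n; apply Rmult_le_pos; [apply pow2_ge_0|apply Rlt_le, Hw].
- intros n Hn; simpl ground.
  pose proof (HN n ltac:(lia)); pose proof (HM n ltac:(lia)).
  pose proof (Hr n); pose proof (Hw (S n)).
  replace ((ratio w l n * ground w l n) ^ 2 * w (S n))
    with (ground w l n ^ 2 * (ratio w l n ^ 2 * w (S n))) by ring.
  replace (q * (ground w l n ^ 2 * w n))
    with (ground w l n ^ 2 * (q ^ 2 * (/ q * w n))) by (field; lra).
  apply Rmult_le_compat_l; [apply pow2_ge_0|].
  apply Rmult_le_compat; [apply pow2_ge_0|lra| |lra].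
  apply pow_incr; lra.
Qed.

(** * Weights with a large drop: strict bound and maximizer *)

Lemma extremal_of_U_gt_1 (w : nat -> R) :
  (forall n, 0 < w n) -> is_lim_seq (fun n => w n / w (S n)) 1 ->
  Rbar_lt 1 (U w) -> exists f, extremal w f.
Proof.
intros Hw Hl HU1; destruct (U_finite w Hw Hl) as [u HU].
rewrite HU in HU1; simpl in HU1.
destruct (classic (forall n, 0 < ratio w u n)) as [Hr|Hr].
- destruct (ratio_eventually_small w u Hw Hl HU HU1 Hr) as [N HN].
  assert (Hx : admissible w (ground w u)).
  { apply ground_admissible with (/ u) N; auto.
    split; [apply Rinv_0_lt_compat; lra|].
    rewrite <- Rinv_1; apply Rinv_lt_contravar; lra. }
  apply extremal_exists with (ground w u) 0%nat u; auto; [simpl; lra|].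
  apply Rminus_le, (is_lim_seq_le (sum_n (fun n => u * (ground w u n ^ 2 * w (S n))
      - ground w u (S n) * ground w u n * w (S n))) (fun _ => 0)
      (u * den w (ground w u) - num w (ground w u)) 0).
  (* Here the boundary term equals [- r_n x_n^2 w_(n+1) / 2], so every partial sum is
     nonpositive. *)
  + intro n; rewrite <- (ground_sum w _ (ratio w u) u n Hw) by (simpl; auto).
    simpl ground.
    assert (0 <= ratio w u n * ground w u n ^ 2 * w (S n)); [|nra].
    pose proof (Hr n); pose proof (Hw (S n)).
    apply Rmult_le_pos; [apply Rmult_le_pos; [lra|apply pow2_ge_0]|lra].
  + exact (Series_num_den w _ u Hw Hl Hx).
  + apply is_lim_seq_const.
- (* At the first nonpositive ratio the truncated solution is a maximizer. *)
  apply not_all_ex_not in Hr.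
  destruct (dec_inh_nat_subset_has_unique_least_element
    (fun n => ~ 0 < ratio w u n) (fun n => classic _) Hr) as [n [[Hn Hmin] _]].
  assert (Hlt : forall j, (j < n)%nat -> 0 < ratio w u j).
  { intros j Hj; apply NNPP; intro H; apply Hmin in H; lia. }
  set (y := fun k => if le_dec k n then ground w u k else 0).
  assert (Hy : forall k, (k <= n)%nat -> y k = ground w u k)
    by (intros k Hk; unfold y; destruct (le_dec k n); [reflexivity|lia]).
  assert (Hy0 : forall k, (n < k)%nat -> y k = 0)
    by (intros k Hk; unfold y; destruct (le_dec k n); [lia|reflexivity]).
  assert (Hyw : admissible w y).
  { split.
    - intro k; unfold y; destruct (le_dec k n); [|lra].
      apply Rlt_le, ground_pos; intros; apply Hlt; lia.
    - apply ex_series_finite with n; intros k Hk; rewrite Hy0 by lia; ring. }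
  apply extremal_exists with y 0%nat u; auto.
  { rewrite Hy by lia; simpl; lra. }
  pose proof (is_series_unique _ _ (Series_num_den w y u Hw Hl Hyw)) as E.
  rewrite (is_series_unique _ _ (is_series_finite
    (fun k => u * (y k ^ 2 * w (S k)) - y (S k) * y k * w (S k)) n
    ltac:(intros k Hk; simpl; rewrite (Hy0 k), (Hy0 (S k)) by lia; ring))) in E.
  rewrite <- (ground_sum w y (ratio w u) u n Hw) in E; auto.
  (* After the cut only [r_n y_n^2 w_(n+1) / 2] remains, nonpositive because [r_n <= 0]. *)
  + rewrite (Hy0 (S n)) in E by lia.
    assert (0 <= (- ratio w u n) * (y n ^ 2 * w (S n))); [|nra].
    pose proof (Hw (S n)).
    apply Rmult_le_pos; [lra|apply Rmult_le_pos; [apply pow2_ge_0|lra]].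
  + intros j Hj; split; [now apply Hlt|].
    now rewrite 2!Hy by lia.
Qed.

Lemma U_gt_1 (w : nat -> R) (n k : nat) :
  (forall n, 0 < w n) -> is_lim_seq (fun n => w n / w (S n)) 1 ->
  (1 <= n)%nat -> w (k + n + 1)%nat < w (k + 1)%nat / 4 -> Rbar_lt 1 (U w).
Proof.
intros Hw Hl Hn Hlt.
(* An initial value [c] followed by ones gains [c (1 - c) w_(k+1)] and loses [w_(k+n+1)] in
   [num - den]; [c = 1/2] maximizes the gain, which is the source of the factor 1/4. *)
set (x := fun j => if lt_dec j k then 0 else if Nat.eq_dec j k then / 2 else
  if le_dec j (k + n) then 1 else 0).
assert (Hx : admissible w x).
{ split.
  - intro j; unfold x; destruct (lt_dec j k), (Nat.eq_dec j k), (le_dec j (k + n)); lra.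
  - apply ex_series_finite with (k + n)%nat; intros j Hj; unfold x.
    destruct (lt_dec j k), (Nat.eq_dec j k), (le_dec j (k + n)); try lia; ring. }
assert (Hxk : x k <> 0).
{ unfold x; destruct (lt_dec k k), (Nat.eq_dec k k); try lia; lra. }
apply Rbar_lt_le_trans with (2 := U_ge w x k Hw Hl Hx Hxk).
pose proof (den_pos w x k Hw Hl Hx Hxk) as Hd.
apply (Rlt_div_r 1); [exact Hd|].
(* Only [j = k] and [j = k + n] contribute to the sum of [x_j (x_(j+1) - x_j) w_(j+1)]. *)
assert (E := is_series_plus (K := R_AbsRing) (V := R_NormedModule) _ _ _ _
  (is_series_single (fun j => if Nat.eq_dec j k then - w (S j) / 4 else 0) k
    ltac:(intros j Hj; simpl; now destruct (Nat.eq_dec j k)))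
  (is_series_single (fun j => if Nat.eq_dec j (k + n) then w (S j) else 0) (k + n)
    ltac:(intros j Hj; simpl; now destruct (Nat.eq_dec j (k + n))))).
assert (E' := is_series_unique _ _ (Series_num_den w x 1 Hw Hl Hx)).
erewrite Series_ext in E'; [rewrite (is_series_unique _ _ E) in E'|].
- destruct (Nat.eq_dec k k), (Nat.eq_dec (k + n) (k + n)); try lia.
  change plus with Rplus in E'.
  replace (S k) with (k + 1)%nat in E' by lia.
  replace (S (k + n)) with (k + n + 1)%nat in E' by lia.
  lra.
- intro j; change plus with Rplus; cbv beta; unfold x.
  destruct (lt_dec j k), (Nat.eq_dec j k), (le_dec j (k + n)),
    (lt_dec (S j) k), (Nat.eq_dec (S j) k), (le_dec (S j) (k + n)),
    (Nat.eq_dec j (k + n)); try lia; field.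
Qed.

(** * Nondecreasing weights, and the lower bound 1 *)

Lemma num_defect_le_den (w : nat -> R) :
  (forall n, 0 < w n) -> is_lim_seq (fun n => w n / w (S n)) 1 ->
  (forall n, w n <= w (S n)) ->
  forall x, admissible w x -> forall m,
  num w x + w (S m) * (x (S m) - x m) ^ 2 / 2 <= den w x.
Proof.
intros Hw Hl Hmono x Hx m.
(* The inserted factors 1 give the goal the shape of [schur] with [r = 1] and [l = 1]. *)
rewrite <- (Rmult_1_l (x m)), <- (Rmult_1_r 2), <- (Rmult_1_l (den w x)); revert m.
apply (schur w x (fun _ => 1)); auto; try (intros; lra).
intro n; assert (w (S n) / w (S (S n)) <= 1); [|lra].
apply Rle_div_l; [apply Hw|]; rewrite Rmult_1_l; apply Hmono.
Qed.

(** Equality makes every defect vanish, so [x] is constant; then [x_n^2 w_n >= x_0^2 w_0 > 0] cannot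
    tend to 0, against summability. *)
Lemma num_lt_den (w x : nat -> R) (m : nat) :
  (forall n, 0 < w n) -> is_lim_seq (fun n => w n / w (S n)) 1 ->
  (forall n, w n <= w (S n)) -> admissible w x -> x m <> 0 ->
  num w x < den w x.
Proof.
intros Hw Hl Hmono Hx Hm; apply Rnot_le_lt; intro Hge; apply Hm.
assert (Hstep : forall n, x (S n) = x n).
{ intro n; pose proof (num_defect_le_den w Hw Hl Hmono x Hx n); pose proof (Hw (S n)).
  apply Rminus_diag_uniq; apply NNPP; intro Hne.
  pose proof (pow2_gt_0 _ Hne); nra. }
assert (Hc : forall n, x n = x 0%nat) by (induction n as [|n IH]; congruence).
assert (Hw0 : forall n, w 0%nat <= w n)
  by (induction n as [|n IH]; [lra|apply Rle_trans with (1 := IH), Hmono]).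
apply NNPP; intro Hne; rewrite Hc in Hne.
assert (Hlim := ex_series_lim_0 _ (proj2 Hx)).
pose proof (is_lim_seq_le (fun _ => x 0%nat ^ 2 * w 0%nat) (fun n => x n ^ 2 * w n)
  (x 0%nat ^ 2 * w 0%nat) 0) as H; simpl in H.
assert (0 < x 0%nat ^ 2 * w 0%nat)
  by (apply Rmult_lt_0_compat; [now apply pow2_gt_0|apply Hw]).
assert (x 0%nat ^ 2 * w 0%nat <= 0); [|lra].
apply H; [|apply is_lim_seq_const|exact Hlim].
intro n; rewrite (Hc n); apply Rmult_le_compat_l; [apply pow2_ge_0|apply Hw0].
Qed.

(* Tests with [x = 1] on [0..n]: with [S_n = w_1 + ... + w_(n+1)], the bound [u < 1] would give
   [(1 - u) S_n <= w_(n+1)], although [S_n / w_(n+1)] grows by nearly one at each step. *)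
Lemma U_ge_1 (w : nat -> R) :
  (forall n, 0 < w n) -> is_lim_seq (fun n => w n / w (S n)) 1 ->
  Rbar_le 1 (U w).
Proof.
intros Hw Hl; destruct (U_finite w Hw Hl) as [u HU]; rewrite HU; simpl.
apply Rnot_lt_le; intro Hu.
set (s := fun n => sum_n (fun k => w (S k)) n / w (S n)).
assert (Hs : forall n, (1 - u) * s n <= 1).
{ intro n.
  set (x := fun k => if le_dec k n then 1 else 0).
  assert (Hx : admissible w x).
  { split; [intro k; unfold x; destruct (le_dec k n); lra|].
    apply ex_series_finite with n; intros k Hk; unfold x.
    destruct (le_dec k n); [lia|ring]. }
  assert (Hx0 : x 0%nat <> 0) by (unfold x; destruct (le_dec 0 n); [lra|lia]).
  pose proof (U_ge w x 0 Hw Hl Hx Hx0) as Hge; rewrite HU in Hge; simpl in Hge.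
  apply Rle_div_l in Hge; [|now apply (den_pos w x 0)].
  assert (Hd : den w x = sum_n (fun k => w (S k)) n).
  { apply is_series_unique.
    rewrite (sum_n_ext_loc (fun k => w (S k)) (fun k => x k ^ 2 * w (S k))).
    - apply is_series_finite; intros k Hk; unfold x.
      destruct (le_dec k n); [lia|ring].
    - intros k Hk; apply Rminus_diag_uniq; unfold x; destruct (le_dec k n); [ring|lia]. }
  (* In [den - num] only the last index [n] contributes, with [w_(n+1)]. *)
  assert (E := is_series_unique _ _ (Series_num_den w x 1 Hw Hl Hx)).
  assert (E' := is_series_single (fun k => if Nat.eq_dec k n then w (S k) else 0) n
    ltac:(intros j Hj; simpl; now destruct (Nat.eq_dec j n))).
  erewrite Series_ext in E; [rewrite (is_series_unique _ _ E') in E|].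
  - destruct (Nat.eq_dec n n); [|lia].
    unfold s; rewrite <- Hd, Rmult_div_assoc.
    apply Rle_div_l; [apply Hw|lra].
  - intro j; cbv beta; unfold x.
    destruct (le_dec j n), (le_dec (S j) n), (Nat.eq_dec j n); try lia; ring. }
assert (Hrec : forall n, s (S n) = 1 + w (S n) / w (S (S n)) * s n).
{ intro n; unfold s; rewrite sum_n_succ.
  pose proof (Hw (S n)); pose proof (Hw (S (S n))); field; lra. }
apply is_lim_seq_spec in Hl.
assert (He : 0 < (1 - u) / 2) by lra.
destruct (Hl (mkposreal _ He)) as [N HN]; simpl in HN.
assert (Hs0 : forall n, 0 < s n).
{ intro n; apply Rlt_le_trans with 1; [lra|].
  apply Rle_div_r; [apply Hw|].
  rewrite Rmult_1_l; apply (sum_n_term_le (fun k => w (S k)) n n); [|lia].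
  intro k; apply Rlt_le, Hw. }
(* Past [N] the weight ratio exceeds [1 - (1 - u) / 2], so a step adds at least
   [1 - (1 - u) s_n / 2 >= 1/2], by [Hs]. *)
assert (Hgrow : forall n, INR n / 2 <= s (N + n)%nat).
{ induction n as [|n IH]; [pose proof (Hs0 (N + 0)%nat); simpl; lra|].
  rewrite S_INR, Nat.add_succ_r, Hrec.
  pose proof (HN (S (N + n)) ltac:(lia)) as H; apply Rabs_def2 in H.
  pose proof (Hs (N + n)%nat); pose proof (Hs0 (N + n)%nat).
  assert ((1 - (1 - u) / 2) * s (N + n)%nat <= w (S (N + n)) / w (S (S (N + n))) * s (N + n)%nat)
    by (apply Rmult_le_compat_r; lra).
  lra. }
(* With [n + 1 > 2 / (1 - u)], the growth gives [(1 - u) s > 1], contradicting [Hs]. *)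
destruct (nfloor_ex (2 / (1 - u))) as [n Hn].
{ apply Rlt_le, Rdiv_lt_0_compat; lra. }
pose proof (Hgrow (S n)) as Hg; rewrite S_INR in Hg.
pose proof (Hs (N + S n)%nat).
assert (E : 2 / (1 - u) * (1 - u) = 2) by (field; lra).
nra.
Qed.

Theorem theorem2p1 (w : nat -> R)
  (w_pos : forall n : nat, 0 < w n)
  (w_0 : w 0%nat = 1)
  (w_lim : is_lim_seq (fun n : nat => w n / w (S n)) 1) :
  ((exists n k : nat,
      (1 <= n)%nat /\ (1 <= k)%nat /\ w (k + n + 1)%nat < w (k + 1)%nat / 4) ->
    Rbar_lt 1 (U w) /\ exists f : C -> C, extremal w f)
  /\
  ((forall n : nat, w n <= w (S n)) ->
    U w = Finite 1 /\ ~ exists f : C -> C, extremal w f).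
Proof.
split.
- intros [n [k [Hn [_ Hlt]]]].
  assert (H1 := U_gt_1 w n k w_pos w_lim Hn Hlt).
  split; [exact H1|now apply extremal_of_U_gt_1].
- intro Hmono.
  assert (HU : U w = Finite 1).
  { apply Rbar_le_antisym; [|now apply U_ge_1].
    apply U_le; [exact w_pos|exact w_lim|]; intros x Hx.
    destruct (classic (exists m, x m <> 0)) as [[m Hm]|H0].
    - pose proof (num_lt_den w x m w_pos w_lim Hmono Hx Hm); lra.
    - pose proof (num_defect_le_den w w_pos w_lim Hmono x Hx 0).
      pose proof (w_pos 1%nat); pose proof (pow2_ge_0 (x 1%nat - x 0%nat)); nra. }
  split; [exact HU|]; intros [f [Hf [Hnz Hq]]].
  destruct (quotient_le w f w_pos w_lim Hf Hnz) as [Hx [[m Hm] Hle]].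
  rewrite HU in Hq; injection Hq as Hq; rewrite Hq in Hle.
  (* An extremal [f] would give [den <= num] for its coefficient moduli, against the strict
     inequality. *)
  apply Rle_div_r in Hle; [|now apply (den_pos w _ m)].
  pose proof (num_lt_den w _ m w_pos w_lim Hmono Hx Hm); lra.
Qed.
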